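(* Let $\lambda_1\ge\cdots\ge\lambda_k$ be nonnegative integers and let $\boldsymbol v$ be the decreasing lattice path in the closed first quadrant from $(0,\lambda_1)$ to $(k,0)$ with height sequence $\lambda_1\ge\cdots\ge\lambda_k$. Then the number $d_k$ of decreasing lattice paths below $\boldsymbol v$ is $d_1=\lambda_1+1$ when $k=1$, and for $k\ge 2$ \[ d_k=\sum_{i=1}^{k-1}\left[\binom{\lambda_i+k-i+1}{k+1-i}-\binom{\lambda_i-\lambda_k+k-i}{k+1-i}\right]\gamma_i-\sum_{i=1}^{k-2}(\lambda_k+1)\binom{\lambda_i-\lambda_{k-1}+k-i-1}{k-i}\gamma_i, \] where $\gamma_1=1$ and $\gamma_j=-\sum_{i=1}^{j-2}\binom{\lambda_i-\lambda_{j-1}+j-i-1}{j-i}\gamma_i$ for $j\ge 2$.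
   Context: A lattice path is a finite sequence of points of $\mathbb Z^2$; its steps are the difference vectors of consecutive points. A lattice path is decreasing if each step is $(1,0)$ or $(0,-1)$. All paths lie in the closed first quadrant. The height sequence of a decreasing path is the sequence of $y$-coordinates of its horizontal steps $(x,y)\to(x+1,y)$, in order. A decreasing lattice path $\boldsymbol u$ with height sequence $\mu_1\ge\cdots\ge\mu_l$ is below $\boldsymbol v$ if $\boldsymbol u$ goes from $(0,\lambda_1)$ to $(k,0)$ (so $l=k$) and $0\le\mu_i\le\lambda_i$ for all $i$. Conventions: an empty sum $\sum_{i=a}^{b}$ with $a>b$ is $0$; $\binom{a}{b}=0$ for integers $0\le a<b$. *)

(* Defs.v *)
From HB Require Import structures.
From mathcomp Require Import all_boot all_order all_algebra.
From mathcomp Require Import boolp classical_sets functions cardinality.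

Set Implicit Arguments.
Unset Strict Implicit.
Unset Printing Implicit Defensive.

Import Order.TTheory GRing.Theory Num.Theory.
Local Open Scope ring_scope.

Definition lattice_path := seq (int * int).

Definition horizontal (p q : int * int) : bool := q - p == (1, 0).

Definition vertical (p q : int * int) : bool := q - p == (0, -1).

Definition in_quadrant (p : int * int) : bool := (0 <= p.1) && (0 <= p.2).

Definition decreasing (u : lattice_path) : bool :=
  sorted (fun p q => horizontal p q || vertical p q) u && all in_quadrant u.

Definition goes_from_to (p q : int * int) (u : lattice_path) : bool :=
  (ohead u == Some p) && (last p u == q).

Definition heights (u : lattice_path) : seq int :=
  [seq s.1.2 | s <- zip u (behead u) & horizontal s.1 s.2].

(* [all2] is false on sequences of different lengths. *)
Definition below (u v : lattice_path) : bool :=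
  [&& decreasing u,
      goes_from_to (0, head 0 (heights v)) ((size (heights v))%:Z, 0) u
    & all2 (fun m l => 0 <= m <= l) (heights u) (heights v)].

(* Main.v *)
Require Import Defs.
From HB Require Import structures.
From mathcomp Require Import all_boot all_order all_algebra.
From mathcomp Require Import boolp classical_sets functions cardinality.
From mathcomp Require Import zify.

Set Implicit Arguments.
Unset Strict Implicit.
Unset Printing Implicit Defensive.

Import Order.TTheory GRing.Theory Num.Theory.
Local Open Scope ring_scope.
Local Open Scope classical_set_scope.
Local Open Scope card_scope.

(* The paths below [v] that start at height [y] with bounds [l :: ls] still to
   be respected split according to the height [s <= min y l] of their first
   horizontal step, so the count is an iterated sum over the heights.
   Exchanging the order of summation moves the work to the left end: if [G m s]
   counts the sequences [mu_1 >= ... >= mu_(m-1) >= s] with [mu_i <= lam i], then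
   [G m.+1 t] is the sum of [G m s] over [t <= s <= lam m].  By the hockey-stick
   identity [G m] stays an integer combination of the binomials
   ['C(lam i - s + m - i, m - i)], and the boundary terms at [s = lam m] add up
   to the new coefficient [gamma m.+1]. *)

(** A horizontal step uses up a bound and a vertical step a unit of height, hence two nested
    fixpoints. In the concatenation, the first list holds the continuations to the right, or the end
    of the path when no bound is left; the second holds those downwards. *)
Fixpoint bounded_paths (ls : seq nat) (x : int) : nat -> seq lattice_path :=
  fix from_height (y : nat) : seq lattice_path :=
    [seq (x, y%:Z) :: u |
      u <- match ls with
           | [::] => if y == 0 then [:: [::]] else [::]
           | l :: ls' => if (y <= l)%N then bounded_paths ls' (x + 1) y else [::]
           end
           ++ if y is y'.+1 then from_height y' else [::]].

Lemma bounded_pathsE (ls : seq nat) (x : int) (y : nat) :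
  bounded_paths ls x y =
    [seq (x, y%:Z) :: u |
      u <- match ls with
           | [::] => if y == 0 then [:: [::]] else [::]
           | l :: ls' => if (y <= l)%N then bounded_paths ls' (x + 1) y else [::]
           end
           ++ if y is y'.+1 then bounded_paths ls x y' else [::]].
Proof. by case: ls; case: y. Qed.

Arguments bounded_paths : simpl never.

Lemma horizontalE (x y : int) (q : int * int) :
  horizontal (x, y) q = (q == (x + 1, y)).
Proof. by rewrite /horizontal subr_eq -[(1, 0) + _]/(1 + x, 0 + y) (addrC 1) add0r. Qed.

Lemma verticalE (x y : int) (q : int * int) :
  vertical (x, y) q = (q == (x, y - 1)).
Proof. by rewrite /vertical subr_eq -[(0, -1) + _]/(0 + x, -1 + y) (addrC (-1)) add0r. Qed.

Lemma mem_map_cons (T : eqType) (p q : T) (u : seq T) (s : seq (seq T)) :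
  (q :: u \in [seq p :: w | w <- s]) = (q == p) && (u \in s).
Proof.
apply/mapP/andP => [[w ws [-> ->]]|[/eqP -> us]]; first by rewrite eqxx.
by exists u.
Qed.

Lemma nil_notin_bounded_paths (ls : seq nat) (x : int) (y : nat) :
  [::] \notin bounded_paths ls x y.
Proof. by rewrite bounded_pathsE; apply/mapP => -[]. Qed.

Lemma mem_bounded_paths_ohead (ls : seq nat) (x : int) (y : nat) (u : lattice_path) :
  u \in bounded_paths ls x y -> ohead u = Some (x, y%:Z).
Proof. by rewrite bounded_pathsE => /mapP[w _ ->]. Qed.

Lemma uniq_bounded_paths (ls : seq nat) (x : int) (y : nat) :
  uniq (bounded_paths ls x y).
Proof.
elim: ls x y => [|l ls IHls] x y; elim: y => [|y IHy]; rewrite bounded_pathsE.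
- by [].
- by rewrite /= map_inj_uniq // => ? ? [].
- by rewrite cats0 map_inj_uniq // => ? ? [].
rewrite map_inj_uniq; last by move=> ? ? [].
rewrite cat_uniq IHy andbT; apply/andP; split; first by case: ifP.
(* Continuations to the right start at height [y.+1], those downwards at height [y], so the two
   lists are disjoint. *)
apply/hasPn => u /mem_bounded_paths_ohead uv; case: ifP => // _.
by apply/negP => /mem_bounded_paths_ohead; rewrite uv => -[]; lia.
Qed.

(** Induction on the path: its second point decides which of the two lists of continuations can
    contain the rest. *)
Lemma mem_bounded_paths (ls : seq nat) (x : int) (y : nat) (u : lattice_path) :
  0 <= x ->
  (u \in bounded_paths ls x y) =
  [&& decreasing u, goes_from_to (x, y%:Z) (x + (size ls)%:Z, 0) u
    & all2 (fun m l => 0 <= m <= l) (heights u) [seq l%:Z | l <- ls]].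
Proof.
elim: u ls x y => [|p u IHu] ls x y x_ge0.
  by rewrite (negPf (nil_notin_bounded_paths _ _ _)) andbF.
rewrite bounded_pathsE mem_map_cons /goes_from_to /= [Some p == _]/eq_op /=.
have [-> /=|_] := eqVneq p (x, y%:Z); last by rewrite !andbF.
rewrite mem_cat; case: u IHu => [|q u] IHu.
  rewrite /decreasing /in_quadrant /= x_ge0 andbT /=.
  case: y => [|y]; case: ls => [|l ls] /=; rewrite ?addr0 ?eqxx //=;
    rewrite ?(fun_if (fun s => [::] \in s)) ?(negPf (nil_notin_bounded_paths _ _ _)) ?if_same
      ?andbF //.
  by rewrite andbT xpair_eqE andbF.
set U := q :: u in IHu *.
have -> : decreasing ((x, y%:Z) :: U) =
    (horizontal (x, y%:Z) q || vertical (x, y%:Z) q) && decreasing U.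
  by rewrite /decreasing /= /in_quadrant /= x_ge0 /= -!andbA.
have -> : heights ((x, y%:Z) :: U) =
    if horizontal (x, y%:Z) q then y%:Z :: heights U else heights U.
  by rewrite /heights /=; case: ifP.
rewrite horizontalE verticalE.
have notin ls' x' (y' : nat) : q != (x', y'%:Z) -> (U \in bounded_paths ls' x' y') = false.
  move=> qN; apply/negP => /mem_bounded_paths_ohead [qE].
  by rewrite qE eqxx in qN.
have [qE|qN] := eqVneq q (x + 1, y%:Z); rewrite /=.
  have -> : (U \in (if y is y'.+1 then bounded_paths ls x y' else [::])) = false.
    by case: y qE {IHu} => // y qE; rewrite notin // qE xpair_eqE; lia.
  rewrite orbF; case: ls => [|l ls]; first by rewrite /= !andbF; case: ifP.
  rewrite /= (fun_if (fun s => U \in s)) IHu; last by lia.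
  rewrite /goes_from_to /= qE eqxx /= intS addrA lez_nat.
  by case: ifP; rewrite ?andbF.
have -> : (U \in match ls with
           | [::] => if y == 0 then [:: [::]] else [::]
           | l :: ls' => if (y <= l)%N then bounded_paths ls' (x + 1) y else [::]
           end) = false.
  by case: ls => [|l ls]; case: ifP => // _; apply: notin.
rewrite /=; case: y qN => [|y] qN.
  (* A vertical step from height 0 leaves the quadrant. *)
  have [qE|//] := eqVneq q (x, 0%:Z - 1).
  by rewrite /decreasing /= {2}qE /in_quadrant /= !andbF.
have -> : y.+1%:Z - 1 = y%:Z by lia.
have [qE|qN'] := eqVneq q (x, y%:Z); last by rewrite notin.
by rewrite IHu // /goes_from_to /= qE eqxx.
Qed.

Lemma size_bounded_paths_nil (x : int) (y : nat) :
  size (bounded_paths [::] x y) = 1%N.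
Proof.
by elim: y => [|y IHy]; rewrite bounded_pathsE size_map size_cat ?IHy.
Qed.

Lemma size_bounded_paths_cons (l : nat) (ls : seq nat) (x : int) (y : nat) :
  size (bounded_paths (l :: ls) x y) =
  (\sum_(0 <= s < (minn y l).+1) size (bounded_paths ls (x + 1) s))%N.
Proof.
elim: y => [|y IHy]; rewrite bounded_pathsE size_map size_cat.
  by rewrite min0n big_nat1 addn0.
rewrite IHy; case: (leqP y.+1 l) => [yl|ly].
  by rewrite (minn_idPl (ltnW yl)) [RHS]big_nat_recr //= addnC.
by rewrite (minn_idPr _).
Qed.

(** Pascal's rule telescopes the sum. The subtracted term is the first one at [s = L.+1], written so
    that it vanishes for [L = a], where [a - L.+1] would truncate. *)
Lemma hockey_stick (a p t L : nat) : (t <= L <= a)%N ->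
  \sum_(t <= s < L.+1) 'C(a - s + p, p)%:Z =
  'C(a - t + p.+1, p.+1)%:Z - 'C(a - L + p, p.+1)%:Z.
Proof.
move=> /andP[tL La]; elim: L tL La => [|L IH] tL La.
  by move: tL; rewrite leqn0 => /eqP ->; rewrite big_nat1 addnS binS; lia.
move: tL; rewrite leq_eqVlt => /orP[/eqP ->|tL].
  by rewrite big_nat1 addnS binS; lia.
rewrite big_nat_recr //=; last lia.
rewrite IH //; last lia.
have -> : (a - L + p = (a - L.+1 + p).+1)%N by lia.
by rewrite binS; lia.
Qed.

Lemma card_mem_uniq (T : choiceType) (s : seq T) : uniq s -> [set` s] #= `I_(size s).
Proof.
move=> us; apply/card_set_bijP; exists (index^~ s); split.
- by move=> x /= xs; rewrite /mkset index_mem.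
- by move=> x y /set_mem xs /set_mem ys; apply: index_inj.
- move=> i /= ilt; case: s us ilt => // x0 s us ilt.
  by exists (nth x0 (x0 :: s) i); [apply: mem_nth|apply: index_uniq].
Qed.

(** Here [s] is the starting height and [t] that of the first horizontal step, so [t <= minn s l].
    Exchanging the sums turns the weight of [s] into a weight of [t] and removes one bound from the
    paths. *)
Lemma sum_size_bounded_paths_cons (w : nat -> int) (L l : nat) (ls : seq nat) (x : int) :
  (l <= L)%N ->
  \sum_(0 <= s < L.+1) w s * (size (bounded_paths (l :: ls) x s))%:Z =
  \sum_(0 <= t < l.+1)
    (\sum_(t <= s < L.+1) w s) * (size (bounded_paths ls (x + 1) t))%:Z.
Proof.
move=> lL; pose c t := (size (bounded_paths ls (x + 1) t))%:Z.
transitivity (\sum_(0 <= s < L.+1) \sum_(0 <= t < l.+1 | (t <= s)%N) w s * c t).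
  apply: eq_bigr => s _.
  rewrite size_bounded_paths_cons (big_morph Posz PoszD (erefl 0%Z)) -big_distrr /=.
  congr (_ * _); rewrite (big_nat_widen 0 _ l.+1) ?ltnS ?geq_minr //.
  by rewrite big_nat_cond [RHS]big_nat_cond; apply: eq_bigl => t /=; lia.
rewrite (exchange_big_dep_nat xpredT) //=; apply: eq_big_nat => t /andP[_ tl].
by rewrite big_distrl /= [RHS](big_nat_widenl _ 0) //.
Qed.

Theorem theorem3p2 (k : nat) (lam : nat -> nat) (v : lattice_path)
    (gamma : nat -> int)
    (k_gt0 : (0 < k)%N)
    (lam_noninc : forall i : nat, (1 <= i < k)%N -> (lam i.+1 <= lam i)%N)
    (v_decr : decreasing v)
    (v_ends : goes_from_to (0, (lam 1%N)%:Z) (k%:Z, 0) v)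
    (v_heights : heights v = [seq (lam i)%:Z | i <- iota 1 k])
    (gamma1 : gamma 1%N = 1)
    (gammaE : forall j : nat, (2 <= j <= k)%N ->
      gamma j = - \sum_(1 <= i < j.-1)
        'C(lam i - lam j.-1 + j - i - 1, j - i)%:Z * gamma i) :
  exists2 d : nat, [set u : lattice_path | below u v] #= `I_d &
    (k = 1%N -> d = (lam 1 + 1)%N) /\
    ((2 <= k)%N ->
      d%:Z = \sum_(1 <= i < k)
               ('C(lam i + k - i + 1, k + 1 - i)%:Z
                - 'C(lam i - lam k + k - i, k + 1 - i)%:Z) * gamma i
             - \sum_(1 <= i < k.-1)
               (lam k + 1)%:Z
               * 'C(lam i - lam k.-1 + k - i - 1, k - i)%:Z * gamma i).
Proof.
have lam_mono i m : (1 <= i <= m)%N -> (m <= k)%N -> (lam m <= lam i)%N.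
  move=> /andP[i1]; elim: m => [|m IH]; first by rewrite leqn0 => /eqP ->.
  rewrite leq_eqVlt => /orP[/eqP -> //|im] mk.
  by apply: leq_trans (IH _ _); [apply: lam_noninc|..]; lia.
(* The term [i = m] is the constant [gamma m]; in particular [G 1 s = 1]. *)
pose G m s := \sum_(1 <= i < m.+1) 'C(lam i - s + (m - i), m - i)%:Z * gamma i.
have sumG m t : (1 <= m <= k)%N -> (t <= lam m)%N ->
    \sum_(t <= s < (lam m).+1) G m s =
    \sum_(1 <= i < m.+1) ('C(lam i - t + (m - i).+1, (m - i).+1)%:Z
      - 'C(lam i - lam m + (m - i), (m - i).+1)%:Z) * gamma i.
  move=> /andP[m1 mk] tm; rewrite exchange_big_nat /=.
  apply: eq_big_nat => i im; rewrite -big_distrl /= hockey_stick //.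
  by rewrite tm lam_mono.
have sumGS m t : (1 <= m < k)%N -> (t <= lam m)%N ->
    \sum_(t <= s < (lam m).+1) G m s = G m.+1 t.
  move=> /andP[m1 mk] tm; rewrite sumG ?m1 ?(ltnW mk) //.
  (* The boundary terms do not depend on [t]; by the recurrence, their negated sum is [gamma m.+1],
     the last term of [G m.+1 t]. *)
  rewrite /G [RHS]big_nat_recr //= subnn bin0 mul1r gammaE; last by lia.
  rewrite (eq_bigr _ (fun i _ => mulrBl _ _ _)) sumrB; congr (_ - _).
    by apply: eq_big_nat => i im; rewrite subSn //; lia.
  rewrite big_nat_recr //= !subnn addn0 bin_small // mul0r addr0.
  by apply: eq_big_nat => i im; congr ('C(_, _)%:Z * _); lia.
have tailE m : (m < k)%N -> [seq lam i | i <- iota m.+1 (k - m)] =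
    lam m.+1 :: [seq lam i | i <- iota m.+2 (k - m.+1)].
  by move=> mk; rewrite -subnSK.
pose d := size (bounded_paths [seq lam i | i <- iota 1 k] 0 (lam 1)).
(* Paths are cut after their [m]-th horizontal step, at height [s]: [G m s] counts the left parts,
   and the right parts start at [(m, s)]. *)
have dE m : (1 <= m <= k)%N -> d%:Z = \sum_(0 <= s < (lam m).+1) G m s *
    (size (bounded_paths [seq lam i | i <- iota m.+1 (k - m)] m%:Z s))%:Z.
  elim: m => // -[_ _|m IH /andP[_ mk]].
    rewrite /d -[k in iota 1 k]subn0 tailE // size_bounded_paths_cons minnn
      (big_morph Posz PoszD (erefl 0%Z)).
    apply: eq_bigr => s _.
    by rewrite /G big_nat1 subnn bin0 gamma1 !mul1r.
  rewrite IH; last by lia.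
  rewrite tailE // sum_size_bounded_paths_cons ?lam_noninc //.
  apply: eq_big_nat => t tl; rewrite sumGS //; last first.
    by apply: leq_trans (lam_noninc m.+1 _).
  by rewrite [m.+1%:Z + 1]addrC -intS.
exists d.
  have -> : [set u | below u v] =
      [set` bounded_paths [seq lam i | i <- iota 1 k] 0 (lam 1)].
    apply/seteqP; split=> u /=;
      rewrite mem_bounded_paths // /below v_heights !size_map size_iota add0r -map_comp;
      by rewrite -(prednK k_gt0).
  exact/card_mem_uniq/uniq_bounded_paths.
(* For [m = k] only the vertical descent remains, one path for each [s]. The last sum keeps its
   boundary terms, since [gammaE] reaches only up to [k]. *)
have {}dE : d%:Z = \sum_(1 <= i < k.+1) ('C(lam i + (k - i).+1, (k - i).+1)%:Z
      - 'C(lam i - lam k + (k - i), (k - i).+1)%:Z) * gamma i.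
  rewrite (dE k) ?k_gt0 ?leqnn // subnn /=.
  under eq_bigr => s _ do rewrite size_bounded_paths_nil mulr1.
  rewrite sumG ?k_gt0 ?leqnn //.
  by apply: eq_bigr => i _; rewrite subn0.
split=> [k1|k2].
  move: dE; rewrite k1 big_nat1 subnn bin1 gamma1.
  rewrite bin_small; lia.
(* The term [i = k] is [(lam k + 1) * gamma k]; the recurrence for [gamma k] turns it into the
   second sum of the formula. *)
rewrite dE big_nat_recr //= subnn bin1 addn0 bin_small; last by lia.
congr (_ + _).
  by apply: eq_big_nat => i ik; congr (('C(_, _)%:Z - 'C(_, _)%:Z) * _); lia.
rewrite gammaE ?k2 //= subr0 mulrN big_distrr /=.
by congr (- _); apply: eq_bigr => i _; rewrite mulrA.
Qed.
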